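(* Let $G(k)=\sum_{j=0}^{k-1}\frac{1}{(2j+1)^2}$ for integers $k\ge 0$ and $H(k)=\sum_{j=1}^{k-1}\frac{1}{(2j)^2}$ for integers $k\ge 1$. As $n\to\infty$ over the positive integers (both even and odd), the following limits hold: $$\frac{2^{n+1}}{\binom{n}{n/2}}\sum_{k=0}^\infty\frac{\binom{2k}{k}}{4^k(2k+n+1)}\to\pi,$$ $$\frac{2^{n+1}}{\binom{n}{n/2}}\sum_{k=1}^\infty\frac{4^k}{\binom{2k}{k}k(2k+n)}\to\pi^2,$$ $$2\cdot\frac{2^{n+3}}{\binom{n}{n/2}}\sum_{k=0}^\infty\frac{\binom{2k}{k}G(k)}{4^k(2k+n+1)}\to\pi^3,$$ $$6\cdot\frac{2^{n+3}}{\binom{n}{n/2}}\sum_{k=1}^\infty\frac{4^kH(k)}{\binom{2k}{k}k(2k+n)}\to\pi^4,$$ where $\binom{n}{n/2}$ is the generalized binomial coefficient when $n$ is odd.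
   Context: The generalized binomial coefficient is $\binom{n}{n/2}=\dfrac{\Gamma(n+1)}{\Gamma(\frac n2+1)^2}$, where $\Gamma$ is the gamma function. Empty sums are equal to $0$. *)

(* Defs.v *)
From HB Require Import structures.
From mathcomp Require Import all_boot all_order all_algebra.
From mathcomp Require Import all_classical all_reals all_analysis.

Set Implicit Arguments.
Unset Strict Implicit.
Unset Printing Implicit Defensive.

Import Order.TTheory GRing.Theory Num.Theory.
Import numFieldNormedType.Exports.

Local Open Scope classical_set_scope.
Local Open Scope ring_scope.

(* Euler's integral of the second kind; meaningful for 0 < x, which covers
   every argument n + 1 and n / 2 + 1 used below. *)
Definition Gamma (R : realType) (x : R) : R :=
  Rintegral (@lebesgue_measure R) `]0, +oo[ (fun t => t `^ (x - 1) * expR (- t)).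

(* The generalized binomial coefficient "n choose n/2", for n of any parity. *)
Definition cbinom (R : realType) (n : nat) : R :=
  Gamma (n%:R + 1) / Gamma (n%:R / 2 + 1) ^+ 2.

Definition Gsum (R : realType) (k : nat) : R :=
  \sum_(0 <= j < k) 1 / (2 * j%:R + 1) ^+ 2.

Definition Hsum (R : realType) (k : nat) : R :=
  \sum_(1 <= j < k) 1 / (2 * j%:R) ^+ 2.

(* Main.v *)
Require Import Defs.
From HB Require Import structures.
From mathcomp Require Import all_boot all_order all_algebra.
From mathcomp Require Import all_classical all_reals all_analysis.
From mathcomp Require Import measurable_realfun ring lra.

Set Implicit Arguments.
Unset Strict Implicit.
Unset Printing Implicit Defensive.

Import Order.TTheory GRing.Theory Num.Theory.
Import numFieldNormedType.Exports.

Local Open Scope classical_set_scope.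
Local Open Scope ring_scope.

(* Let I m n be the integral of x ^ m (sin x) ^ n over [0, pi / 2]. The four series
   equal I 0 n, 2 I 1 n, I 2 n / 2 and I 3 n / 3. No power series is needed: partial
   sums satisfy telescoping identities in n with step 2, which in the limit become
   the second-order recurrences obtained for I m by integrating by parts. Two
   monotone solutions that agree at n = 1 agree at all odd n, hence, by squeezing,
   everywhere. Since (sin x) ^ n concentrates at pi / 2, I m n / I 0 n tends to
   (pi / 2) ^ m, while the functional equation of Gamma and Gamma (3 / 2) ^ 2 = pi / 4
   give 2 ^ (n + 1) / (n choose n / 2) = pi / I 0 n for n of any parity. *)

(** * The series as weighted sums *)

Section weighted_sums.
Variables (R : realType) (p : nat).

(* For p = 1 this is 'C(2k, k) / 4 ^ k, and for p = 2 it is half of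
   4 ^ (k + 1) / ('C(2k + 2, k + 1) (k + 1)), so that the series [wser] and [wserK]
   below are those of the theorem for p = 1, and half of them for p = 2, after
   shifting the index by one. *)
Definition wcoef (k : nat) : R :=
  \prod_(i < k) ((2 * i%:R + p%:R) / (2 * i%:R + p%:R + 1)).

Definition isqsum (k : nat) : R := \sum_(j < k) 1 / (2 * j%:R + p%:R) ^+ 2.

Definition wsum (N n : nat) : R :=
  \sum_(k < N) wcoef k / (2 * k%:R + n%:R + p%:R).

Definition wsumK (N n : nat) : R :=
  \sum_(k < N) wcoef k * isqsum k / (2 * k%:R + n%:R + p%:R).

Definition wser (n : nat) : R := limn (wsum^~ n).

Definition wserK (n : nat) : R := limn (wsumK^~ n).

Hypothesis p_ge1 : (1 : R) <= p%:R.

Lemma wcoefS k :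
  wcoef k.+1 = wcoef k * ((2 * k%:R + p%:R) / (2 * k%:R + p%:R + 1)).
Proof. by rewrite /wcoef big_ord_recr. Qed.

Lemma wcoef0 : wcoef 0 = 1.
Proof. by rewrite /wcoef big_ord0. Qed.

Lemma wcoef_ge0 k : 0 <= wcoef k.
Proof.
apply: prodr_ge0 => i _.
by rewrite divr_ge0// ?addr_ge0// mulr_ge0.
Qed.

(** With [a = 2 k + p], one step multiplies the left side by [a (a + 2) / (a + 1) ^ 2 <= 1], and its
    value at [k = 0] is [p]. Hence [wcoef k] is of order at most [k ^ (- 1 / 2)]. *)
Lemma wcoef_sqr_le k : wcoef k ^+ 2 * (2 * k%:R + p%:R) <= p%:R.
Proof.
have p1 := p_ge1.
elim: k => [|k IH]; first by rewrite wcoef0; lra.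
apply: le_trans IH; rewrite wcoefS -(natr1 k).
have k0 : (0 : R) <= k%:R by [].
set x : R := k%:R in k0 *; set q : R := p%:R in p1 *; set c := wcoef k.
have -> : (c * ((2 * x + q) / (2 * x + q + 1))) ^+ 2 * (2 * (x + 1) + q) =
    c ^+ 2 * (2 * x + q) * ((2 * x + q) * (2 * x + q + 2) / (2 * x + q + 1) ^+ 2).
  by field; lra.
rewrite ler_piMr//; first by rewrite mulr_ge0 ?sqr_ge0//; lra.
by rewrite ler_pdivrMr ?exprn_gt0//; [nra|lra].
Qed.

Lemma cvg_wcoef : wcoef @ \oo --> 0.
Proof.
have p1 := p_ge1.
have sqr0 : (fun k => wcoef k ^+ 2) @ \oo --> 0.
  apply: (@squeeze_cvgr _ _ _ _ (cst 0) (fun k : nat => p%:R * harmonic k)).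
  - near=> k; rewrite sqr_ge0/= /harmonic.
    have k0 : (0 : R) <= k%:R by [].
    rewrite ler_pdivlMr//; apply: le_trans (wcoef_sqr_le k).
    by rewrite ler_wpM2l ?sqr_ge0// -(natr1 k); lra.
  - exact: cvg_cst.
  - by rewrite -[X in _ --> X](mulr0 p%:R); apply: cvgMr; exact: cvg_harmonic.
have := cvg_comp _ _ sqr0 (@sqrt_continuous R 0).
rewrite sqrtr0; apply: cvg_trans; apply: near_eq_cvg; near=> k => /=.
by rewrite sqrtr_sqr ger0_norm// wcoef_ge0.
Unshelve. all: by end_near. Qed.

Lemma isqsumS k : isqsum k.+1 = isqsum k + 1 / (2 * k%:R + p%:R) ^+ 2.
Proof. by rewrite /isqsum big_ord_recr. Qed.

Lemma isqsum0 : isqsum 0 = 0.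
Proof. by rewrite /isqsum big_ord0. Qed.

Lemma isqsum_ge0 k : 0 <= isqsum k.
Proof. by apply: sumr_ge0 => i _; rewrite divr_ge0// sqr_ge0. Qed.

Lemma isqsum_le k : isqsum k <= 3 / 2.
Proof.
have p1 := p_ge1.
(* The telescoping majorant of the terms is [3 / ((2 k + 1) (2 k + 3))]; 3 is the least constant for
   which it dominates [1 / (2 k + 1) ^ 2] at [k = 0]. *)
suff : isqsum k <= 3 / 2 - 3 / 2 / (2 * k%:R + 1).
  move=> /le_trans; apply; rewrite gerBl.
  by have k0 : (0 : R) <= k%:R by []; rewrite divr_ge0//; lra.
elim: k => [|k IH]; first by rewrite isqsum0 mulr0 add0r divr1 subrr.
have k0 : (0 : R) <= k%:R by [].
rewrite isqsumS -(natr1 k); move: IH; set x : R := k%:R in k0 *; set q : R := p%:R in p1 *.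
move=> IH.
have : 1 / (2 * x + q) ^+ 2 <= 3 / 2 / (2 * x + 1) - 3 / 2 / (2 * (x + 1) + 1).
  have -> : 3 / 2 / (2 * x + 1) - 3 / 2 / (2 * (x + 1) + 1) =
            3 / ((2 * x + 1) * (2 * x + 3)) by field; lra.
  rewrite ler_pdivlMr; last by nra.
  rewrite mulrAC ler_pdivrMr ?exprn_gt0//; last lra.
  nra.
lra.
Qed.

Lemma wsumS N n : wsum N.+1 n = wsum N n + wcoef N / (2 * N%:R + n%:R + p%:R).
Proof. by rewrite /wsum big_ord_recr. Qed.

Lemma wsumKS N n : wsumK N.+1 n =
  wsumK N n + wcoef N * isqsum N / (2 * N%:R + n%:R + p%:R).
Proof. by rewrite /wsumK big_ord_recr. Qed.

Lemma wsum0 n : wsum 0 n = 0. Proof. by rewrite /wsum big_ord0. Qed.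

Lemma wsumK0 n : wsumK 0 n = 0. Proof. by rewrite /wsumK big_ord0. Qed.

(** The combined summand [wcoef k * ((n + 1) / (2 k + n + p) - (n + 2) / (2 k + n + p + 2))] is the
    increment of the last term on the right from [k] to [k + 1]; the constant cancels that term at
    [N = 0]. *)
Lemma wsum_rec N n :
  (n%:R + 1) * wsum N n - (n%:R + 2) * wsum N n.+2 =
  (1 - p%:R) / (n%:R + p%:R)
  + wcoef N * ((2 * N%:R + p%:R - 1) / (2 * N%:R + n%:R + p%:R)).
Proof.
have p1 := p_ge1.
have n0 : (0 : R) <= n%:R by [].
elim: N => [|N IH]; first by rewrite !wsum0 wcoef0; field; lra.
have N0 : (0 : R) <= N%:R by [].
have := IH; rewrite !wsumS wcoefS -!(natr1 n.+1) -!(natr1 n) -!(natr1 N) => IH'.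
rewrite !mulrDr opprD addrACA IH'.
by field; lra.
Qed.

(** Summation by parts against [wsum_rec]: the increment [1 / (2 k + p) ^ 2] of [isqsum] leaves
    [wcoef k / ((2 k + p) (2 k + p + n + 2))], which partial fractions split into the terms of
    [wsum N 0] and [wsum N n.+2]. *)
Lemma wsumK_rec N n :
  (n%:R + 1) * wsumK N n - (n%:R + 2) * wsumK N n.+2 =
  - (wsum N 0 - wsum N n.+2) / (n%:R + 2)
  + wcoef N * isqsum N * ((2 * N%:R + p%:R - 1) / (2 * N%:R + n%:R + p%:R)).
Proof.
have p1 := p_ge1.
have n0 : (0 : R) <= n%:R by [].
elim: N => [|N IH]; first by rewrite !wsumK0 !wsum0 isqsum0; field; lra.
have N0 : (0 : R) <= N%:R by [].
have := IH; rewrite !wsumKS !wsumS isqsumS wcoefS -!(natr1 n.+1) -!(natr1 n) -!(natr1 N) => IH'.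
rewrite !mulrDr opprD addrACA IH'.
by field; lra.
Qed.

(** The summand [wcoef k / (2 k + p + 1)] equals [wcoef k - wcoef k.+1]. *)
Lemma wsum1 N : wsum N 1 = 1 - wcoef N.
Proof.
have p1 := p_ge1.
elim: N => [|N IH]; first by rewrite wsum0 wcoef0 subrr.
have N0 : (0 : R) <= N%:R by [].
by rewrite wsumS IH wcoefS; field; lra.
Qed.

(** Summation by parts against [wsum1], with [1 / ((2 k + p) (2 k + p + 1))] split into partial
    fractions. *)
Lemma wsumK1 N : wsumK N 1 = wsum N 0 - wsum N 1 - wcoef N * isqsum N.
Proof.
have p1 := p_ge1.
elim: N => [|N IH]; first by rewrite wsumK0 !wsum0 isqsum0; lra.
have N0 : (0 : R) <= N%:R by [].
by rewrite wsumKS IH !wsumS wcoefS isqsumS; field; lra.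
Qed.

(** * Convergence of the sums and recurrences of their limits *)

Let term_ge0 N n : 0 <= wcoef N / (2 * N%:R + n%:R + p%:R).
Proof. by rewrite divr_ge0 ?wcoef_ge0// !addr_ge0// mulr_ge0. Qed.

Let termK_ge0 N n : 0 <= wcoef N * isqsum N / (2 * N%:R + n%:R + p%:R).
Proof. by rewrite divr_ge0// ?mulr_ge0 ?wcoef_ge0 ?isqsum_ge0// !addr_ge0// mulr_ge0. Qed.

(** As [2 k + 1 + p <= 2 (2 k + n + p)], each term is at most twice that of the telescoping sum
    [wsum N 1]. *)
Let wsum_le2 N n : wsum N n <= 2.
Proof.
have p1 := p_ge1.
apply: (@le_trans _ _ (2 * wsum N 1)); last first.
  by rewrite wsum1; have := wcoef_ge0 N; lra.
rewrite /wsum mulr_sumr; apply: ler_sum => i _.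
have i0 : (0 : R) <= i%:R by []. have n0 : (0 : R) <= n%:R by [].
rewrite mulrCA ler_wpM2l ?wcoef_ge0//.
by rewrite -[leRHS]invf_div lef_pV2 ?posrE; lra.
Qed.

Lemma is_cvg_wsum n : cvgn (wsum^~ n).
Proof.
apply: nondecreasing_is_cvgn.
  by apply/nondecreasing_seqP => N; rewrite wsumS lerDl.
by exists 2 => _ [N _ <-]; exact: wsum_le2.
Qed.

Lemma is_cvg_wsumK n : cvgn (wsumK^~ n).
Proof.
apply: nondecreasing_is_cvgn.
  by apply/nondecreasing_seqP => N; rewrite wsumKS lerDl.
exists (3 / 2 * 2) => _ [N _ <-].
apply: (@le_trans _ _ (3 / 2 * wsum N n)); last by rewrite ler_wpM2l.
rewrite /wsumK /wsum mulr_sumr; apply: ler_sum => i _.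
by rewrite -mulrA mulrCA ler_wpM2r// isqsum_le.
Qed.

Lemma wser_nonincr n : wser n.+1 <= wser n.
Proof.
have p1 := p_ge1.
apply: ler_lim; [exact: is_cvg_wsum..|near=> N].
rewrite /wsum; apply: ler_sum => i _; rewrite ler_wpM2l ?wcoef_ge0//.
have i0 : (0 : R) <= i%:R by []. have n0 : (0 : R) <= n%:R by [].
by rewrite lef_pV2 ?posrE -?(natr1 n); lra.
Unshelve. all: by end_near. Qed.

Lemma wserK_nonincr n : wserK n.+1 <= wserK n.
Proof.
have p1 := p_ge1.
apply: ler_lim; [exact: is_cvg_wsumK..|near=> N].
rewrite /wsumK; apply: ler_sum => i _.
rewrite ler_wpM2l ?mulr_ge0 ?wcoef_ge0 ?isqsum_ge0//.
have i0 : (0 : R) <= i%:R by []. have n0 : (0 : R) <= n%:R by [].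
by rewrite lef_pV2 ?posrE -?(natr1 n); lra.
Unshelve. all: by end_near. Qed.

Let cvg_wcoefM (u : R^nat) (C : R) : (forall N, `|u N| <= C) ->
  wcoef N * u N @[N --> \oo] --> 0.
Proof.
move=> uC; apply/norm_cvg0P.
apply: (@squeeze_cvgr _ _ _ _ (cst 0) (fun N => wcoef N * C)).
- near=> N; rewrite normr_ge0/= normrM ger0_norm ?wcoef_ge0//.
  by rewrite ler_wpM2l ?wcoef_ge0.
- exact: cvg_cst.
- by rewrite -[X in _ --> X](mul0r C); apply: cvgMl; exact: cvg_wcoef.
Unshelve. all: by end_near. Qed.

Let rest_le1 n N : `|(2 * N%:R + p%:R - 1) / (2 * N%:R + n%:R + p%:R)| <= 1 :> R.
Proof.
have p1 := p_ge1.
have N0 : (0 : R) <= N%:R by []. have n0 : (0 : R) <= n%:R by [].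
rewrite ger0_norm; last by rewrite divr_ge0; lra.
by rewrite ler_pdivrMr; lra.
Qed.

(** In the limit of [wsum_rec] the boundary term disappears with [wcoef N]. The recurrence is
    homogeneous for [p = 1] and has forcing term 1 for [p = 2], like the sine moments of order 0 and
    1. *)
Lemma wser_rec n : (n%:R + 2) * (n%:R + p%:R) * wser n.+2 =
  (n%:R + 1) * (n%:R + p%:R) * wser n + (p%:R - 1).
Proof.
have p1 := p_ge1.
have n0 : (0 : R) <= n%:R by [].
suff : (n%:R + 1) * wser n - (n%:R + 2) * wser n.+2 = (1 - p%:R) / (n%:R + p%:R).
  move=> /(congr1 (fun z => z * (n%:R + p%:R))).
  by rewrite divfK; [lra|lra].
transitivity (limn (fun N => (n%:R + 1) * wsum N n - (n%:R + 2) * wsum N n.+2)).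
- by apply/esym/cvg_lim => //; apply: cvgB; apply: cvgMr; exact: is_cvg_wsum.
- apply/cvg_lim => //; rewrite -[X in _ --> X]addr0; under eq_fun do rewrite wsum_rec.
  by apply: cvgD; [exact: cvg_cst|exact: (cvg_wcoefM (rest_le1 n))].
Qed.

Lemma wserK_rec n : (n%:R + 2) ^+ 2 * wserK n.+2 =
  (n%:R + 1) * (n%:R + 2) * wserK n + (wser 0 - wser n.+2).
Proof.
have p1 := p_ge1.
have n0 : (0 : R) <= n%:R by [].
suff : (n%:R + 1) * wserK n - (n%:R + 2) * wserK n.+2 =
    - (wser 0 - wser n.+2) / (n%:R + 2).
  move=> /(congr1 (fun z => z * (n%:R + 2))).
  by rewrite divfK; [lra|lra].
transitivity (limn (fun N => (n%:R + 1) * wsumK N n - (n%:R + 2) * wsumK N n.+2)).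
- by apply/esym/cvg_lim => //; apply: cvgB; apply: cvgMr; exact: is_cvg_wsumK.
- apply/cvg_lim => //; rewrite -[X in _ --> X]addr0; under eq_fun do rewrite wsumK_rec -mulrA.
  apply: cvgD.
    by apply: cvgMl; apply: cvgN; apply: cvgB; exact: is_cvg_wsum.
  apply: (@cvg_wcoefM _ (3 / 2)) => N; rewrite normrM -[leRHS]mulr1.
  by rewrite ler_pM// ger0_norm ?isqsum_ge0// isqsum_le.
Qed.

Lemma wser1 : wser 1 = 1.
Proof.
apply/cvg_lim => //; rewrite -[X in _ --> X]subr0; under eq_fun do rewrite wsum1.
by apply: cvgB; [exact: cvg_cst|exact: cvg_wcoef].
Qed.

Lemma wserK1 : wserK 1 = wser 0 - wser 1.
Proof.
apply/cvg_lim => //; rewrite -[X in _ --> X]subr0; under eq_fun do rewrite wsumK1.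
apply: cvgB.
  by apply: cvgB; exact: is_cvg_wsum.
apply: (@cvg_wcoefM _ (3 / 2)) => N.
by rewrite ger0_norm ?isqsum_ge0// isqsum_le.
Qed.

End weighted_sums.

(** * Moments of powers of the sine *)

Section derivatives.
Variable R : realType.
Implicit Types f g F : R -> R.

Lemma is_derive1M f g (x df dg : R) :
  is_derive x 1 f df -> is_derive x 1 g dg ->
  is_derive x 1 (fun y => f y * g y) (df * g x + f x * dg).
Proof.
move=> hf hg; apply: is_derive_eq (is_deriveM hf hg) _.
by rewrite /GRing.scale/= addrC [df * _]mulrC.
Qed.

Lemma is_derive1X f n (x df : R) :
  is_derive x 1 f df -> is_derive x 1 (fun y => f y ^+ n) (n%:R * f x ^+ n.-1 * df).
Proof.
move=> hf; have -> : (fun y => f y ^+ n) = f ^+ n.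
  by apply/funext => y; rewrite fctE.
exact: is_deriveX.
Qed.

Lemma is_derive1B f g (x df dg : R) :
  is_derive x 1 f df -> is_derive x 1 g dg ->
  is_derive x 1 (fun y => f y - g y) (df - dg).
Proof. by move=> hf hg; exact: is_deriveB. Qed.

Lemma is_derive1Zl f (x df a : R) :
  is_derive x 1 f df -> is_derive x 1 (fun y => a * f y) (a * df).
Proof. by move=> hf; exact: is_deriveZ. Qed.

Lemma is_derive1_continuous f (x df : R) : is_derive x 1 f df -> {for x, continuous f}.
Proof. by move=> [hf _]; apply: differentiable_continuous; apply/derivable1_diffP. Qed.

End derivatives.

Section trigonometric_moments.
Variable R : realType.
Implicit Types f g F : R -> R.
Local Notation mu := (@lebesgue_measure R).
Local Notation dom := `[0, (pi / 2 : R)]%classic.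
Local Notation J f := (Rintegral mu dom f).

Let pihalf_gt0 : (0 : R) < pi / 2.
Proof. by rewrite divr_gt0 ?pi_gt0. Qed.

Let integrableJ f : continuous f -> mu.-integrable dom (EFin \o f).
Proof.
move=> cf; apply: continuous_compact_integrable; first exact: segment_compact.
exact: continuous_subspaceT.
Qed.

Let JD f g : continuous f -> continuous g -> J (fun x => f x + g x) = J f + J g.
Proof. by move=> cf cg; rewrite RintegralD//; exact: integrableJ. Qed.

Let JB f g : continuous f -> continuous g -> J (fun x => f x - g x) = J f - J g.
Proof. by move=> cf cg; rewrite RintegralB//; exact: integrableJ. Qed.

Let JZ f a : continuous f -> J (fun x => a * f x) = a * J f.
Proof. by move=> cf; rewrite RintegralZl//; exact: integrableJ. Qed.

Let le_J f g : continuous f -> continuous g ->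
  (forall x : R, 0 <= x <= pi / 2 -> f x <= g x) -> J f <= J g.
Proof.
move=> cf cg fg; apply: le_Rintegral; [by []|exact: integrableJ cf|exact: integrableJ cg|].
by move=> x /=; rewrite in_itv/=; exact: fg.
Qed.

Let J_FTC f F : continuous f -> (forall x : R, is_derive x 1 F (f x)) ->
  J f = F (pi / 2) - F 0.
Proof.
move=> cf dF; have cF : continuous F.
  by move=> x; exact: is_derive1_continuous (dF x).
rewrite /Rintegral (@continuous_FTC2 _ f F)//=.
- exact: continuous_subspaceT.
- split; [by move=> x _; have [] := dF x| |].
  + by apply: cvg_at_right_filter; exact: cF.
  + by apply: cvg_at_left_filter; exact: cF.
- by move=> x _; rewrite derive1E; have [] := dF x.
Qed.

Definition sinmoment (m n : nat) : R := J (fun x => x ^+ m * sin x ^+ n).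

Let continuous_xsin m n : continuous (fun x : R => x ^+ m * sin x ^+ n).
Proof.
move=> x; apply: is_derive1_continuous; apply: is_derive1M.
  by apply: is_derive1X; exact: is_derive_id.
by apply: is_derive1X; exact: is_derive_sin.
Qed.

Let continuousZ f a : continuous f -> continuous (fun x => a * f x).
Proof. by move=> cf x; apply: cvgMr; exact: cf. Qed.

Let continuousDf f g : continuous f -> continuous g -> continuous (fun x => f x + g x).
Proof. by move=> cf cg x; apply: cvgD; [exact: cf|exact: cg]. Qed.

Let continuousBf f g : continuous f -> continuous g -> continuous (fun x => f x - g x).
Proof. by move=> cf cg x; apply: cvgB; [exact: cf|exact: cg]. Qed.

(** Two integrations by parts, packed into one antiderivative. The truncated predecessors [m.-1] and
    [m.-2] are harmless for small [m], since their coefficients vanish there. *)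
Lemma sinmoment_rec m n :
  (n%:R + 2) ^+ 2 * sinmoment m n.+2 =
  (n%:R + 1) * (n%:R + 2) * sinmoment m n + m%:R * (pi / 2) ^+ m.-1
  - m%:R * m.-1%:R * sinmoment m.-2 n.+2.
Proof.
(* In [F'] the two terms in [x ^ (m - 1) (sin x) ^ (n + 1) cos x] cancel. Only the second part of
   [F] survives at [pi / 2], and nothing at 0. *)
pose F (x : R) := (n.+2)%:R * (x ^+ m * (sin x ^+ n.+1 * cos x))
                  - m%:R * (x ^+ m.-1 * sin x ^+ n.+2).
pose f (x : R) := (n%:R + 1) * (n%:R + 2) * (x ^+ m * sin x ^+ n)
  - (n%:R + 2) ^+ 2 * (x ^+ m * sin x ^+ n.+2)
  - m%:R * m.-1%:R * (x ^+ m.-2 * sin x ^+ n.+2).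
have cf : continuous f.
  by apply: continuousBf; [apply: continuousBf|]; apply: continuousZ.
have dF (x : R) : is_derive x 1 F (f x).
  apply: is_derive_eq.
    apply: is_derive1B; apply: is_derive1Zl; apply: is_derive1M;
      try (by apply: is_derive1X; exact: is_derive_id);
      try (by apply: is_derive1X; exact: is_derive_sin).
    by apply: is_derive1M; apply: is_derive1X; exact: is_derive_sin.
  rewrite /f /= -!natr1 !exprS.
  have := cos2Dsin2 x; set s := sin x; set c := cos x => cs.
  have c2 : c * c = 1 - s * s by rewrite -!expr2 -cs; ring.
  transitivity ((n%:R + 1 + 1) * (m%:R * x ^+ m.-1 * 1 * (s * s ^+ n * c) +
       x ^+ m * ((n%:R + 1) * s ^+ n * (c * c) - s * s ^+ n * s)) -
    m%:R * (m.-1%:R * x ^+ m.-2 * 1 * (s * (s * s ^+ n)) +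
     x ^+ m.-1 * ((n%:R + 1 + 1) * (s * s ^+ n) * c))); first by ring.
  by rewrite c2; ring.
have := J_FTC cf dF.
have -> : F (pi / 2) = - (m%:R * (pi / 2) ^+ m.-1).
  by rewrite /F cos_pihalf sin_pihalf !expr1n !mulr0 !mulr1 sub0r.
have -> : F 0 = 0.
  by rewrite /F sin0 !expr0n/= !(mul0r, mulr0) subr0.
rewrite /f JB ?JB ?JZ//; do ?[by apply: continuousZ]; last first.
  by apply: continuousBf; apply: continuousZ.
rewrite -!/(sinmoment _ _); lra.
Qed.

(** The term [(m == 0)] is the boundary value of [x ^ m cos x] at 0, where [0 ^ 0 = 1]. *)
Lemma sinmoment_id1 m : sinmoment m 1 =
  m%:R * (pi / 2) ^+ m.-1 + (m == 0)%:R - m%:R * m.-1%:R * sinmoment m.-2 1.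
Proof.
pose F (x : R) := m%:R * (x ^+ m.-1 * sin x ^+ 1) - x ^+ m * cos x.
pose f (x : R) := x ^+ m * sin x ^+ 1 + m%:R * m.-1%:R * (x ^+ m.-2 * sin x ^+ 1).
have cf : continuous f by apply: continuousDf => //; apply: continuousZ.
have dF (x : R) : is_derive x 1 F (f x).
  apply: is_derive_eq.
    apply: is_derive1B; [apply: is_derive1Zl|]; apply: is_derive1M;
      try (by apply: is_derive1X; exact: is_derive_id);
      try (by apply: is_derive1X; exact: is_derive_sin).
  by rewrite /f /= ?expr1 ?expr0; ring.
have := J_FTC cf dF.
have -> : F (pi / 2) = m%:R * (pi / 2) ^+ m.-1.
  by rewrite /F cos_pihalf sin_pihalf !expr1n !mulr0 !mulr1 subr0.
have -> : F 0 = - (m == 0)%:R.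
  by rewrite /F sin0 cos0 expr1 !mulr0 mulr1 sub0r expr0n.
rewrite /f JD ?JZ//; do ?[by apply: continuousZ].
rewrite -!/(sinmoment _ _); lra.
Qed.

Lemma sinmoment_n0 m : sinmoment m 0 = (pi / 2) ^+ m.+1 / m.+1%:R.
Proof.
have dF (x : R) : is_derive x 1 (fun x => m.+1%:R^-1 * x ^+ m.+1) (x ^+ m * sin x ^+ 0).
  apply: is_derive_eq.
    by apply: is_derive1Zl; apply: is_derive1X; exact: is_derive_id.
  by rewrite /= expr0 !mulr1 mulKf// pnatr_eq0.
rewrite /sinmoment (J_FTC (@continuous_xsin m 0) dF).
by rewrite expr0n/= mulr0 subr0 mulrC.
Qed.

Let sin01 x : 0 <= x <= (pi / 2 : R) -> 0 <= sin x <= 1.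
Proof.
move=> /andP[x0 xpi]; rewrite sin_le1 andbT sin_ge0_pi// x0/=.
by apply: le_trans xpi _; have := pi_gt0 R; lra.
Qed.

Lemma sinmoment_ge0 m n : 0 <= sinmoment m n.
Proof.
apply: Rintegral_ge0 => x /=; rewrite in_itv/= => x01.
have /andP[s0 _] := sin01 x01; have /andP[x0 _] := x01.
by rewrite mulr_ge0// exprn_ge0.
Qed.

Lemma sinmoment_nonincr m n : sinmoment m n.+1 <= sinmoment m n.
Proof.
apply: le_J => // x x01.
have /andP[s0 s1] := sin01 x01; have /andP[x0 _] := x01.
by rewrite ler_wpM2l ?exprn_ge0// exprS ler_piMl// exprn_ge0.
Qed.

Lemma sinmoment_le m n : sinmoment m n <= (pi / 2) ^+ m * sinmoment 0 n.
Proof.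
rewrite /sinmoment -JZ//; apply: le_J => //; first exact: continuousZ.
move=> x x01; have /andP[s0 s1] := sin01 x01; have /andP[x0 xp] := x01.
rewrite expr0 mul1r ler_wpM2r ?exprn_ge0//.
by apply: lerXn2r; rewrite ?nnegrE// ltW.
Qed.

(* Mean value theorem: [cos x = cos x - cos (pi / 2) >= sin x * (pi / 2 - x)]. *)
Let cos_ge x : 0 <= x <= (pi / 2 : R) -> (pi / 2 - x) * sin x <= cos x.
Proof.
move=> x01; have /andP[x0 xp] := x01.
have [|c /= xc E] := @MVT_segment R cos (fun y => - sin y) x (pi / 2) xp.
  by apply: continuous_subspaceT => y; exact: continuous_cos.
move: xc; rewrite in_itv/= => /andP[xc cp].
have -> : cos x = sin c * (pi / 2 - x) by move: E; rewrite cos_pihalf; lra.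
rewrite mulrC ler_wpM2r ?subr_ge0//.
apply: (@ger0_derive1_ndecr R sin 0 (pi / 2)) => //.
- by move=> y; rewrite in_itv/= => /andP[y0 yp]; rewrite derive1E derive_val;
    apply: cos_ge0_pihalf; apply/andP; split; lra.
- by apply: continuous_subspaceT => y; exact: continuous_sin.
Qed.

(** By [cos_ge] the integrand [(pi / 2 - x) (sin x) ^ (n + 1)] is at most [(sin x) ^ n cos x], an
    exact derivative. This quantifies the concentration at [pi / 2]. *)
Lemma sinmoment01_le n :
  pi / 2 * sinmoment 0 n.+1 - sinmoment 1 n.+1 <= (n%:R + 1)^-1.
Proof.
have dF (x : R) : is_derive x 1 (fun x : R => (n%:R + 1)^-1 * sin x ^+ n.+1)
    (sin x ^+ n * cos x).
  apply: is_derive_eq.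
    by apply: is_derive1Zl; apply: is_derive1X; exact: is_derive_sin.
  by rewrite /= -natr1 mulrA mulrA mulVf ?mul1r// natr1.
have cF : continuous (fun x : R => sin x ^+ n * cos x).
  move=> x; apply: is_derive1_continuous; apply: is_derive1M.
    by apply: is_derive1X; exact: is_derive_sin.
have <- : J (fun x : R => sin x ^+ n * cos x) = (n%:R + 1)^-1.
  rewrite (J_FTC cF dF) sin_pihalf sin0 expr1n mulr1.
  by rewrite expr0n/= mulr0 subr0.
rewrite /sinmoment -JZ// -JB//; last exact: continuousZ.
apply: le_J => //; first by apply: continuousBf => //; exact: continuousZ.
move=> x x01; have /andP[s0 s1] := sin01 x01.
have -> : pi / 2 * (x ^+ 0 * sin x ^+ n.+1) - x ^+ 1 * sin x ^+ n.+1 =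
  sin x ^+ n * ((pi / 2 - x) * sin x) by rewrite expr0 expr1 exprS; ring.
by rewrite ler_wpM2l ?exprn_ge0// cos_ge.
Qed.

(** The difference is the integral of [x ^ m (pi / 2 - x) (sin x) ^ n], and [x ^ m <= (pi / 2) ^ m];
    all orders thus reduce to [m = 0]. *)
Lemma sinmomentS_le m n : 0 <= pi / 2 * sinmoment m n - sinmoment m.+1 n <=
  (pi / 2) ^+ m * (pi / 2 * sinmoment 0 n - sinmoment 1 n).
Proof.
have c1 k : continuous (fun x : R => pi / 2 * (x ^+ k * sin x ^+ n) - x ^+ k.+1 * sin x ^+ n).
  by apply: continuousBf => //; exact: continuousZ.
rewrite /sinmoment -!JZ// -!JB; do ?by [|exact: continuousZ].
rewrite -JZ//; apply/andP; split.
- apply: Rintegral_ge0 => x /=; rewrite in_itv/= => x01.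
  have /andP[s0 s1] := sin01 x01; have /andP[x0 xp] := x01.
  by rewrite exprS -!mulrA mulrA -mulrBl mulr_ge0 ?subr_ge0 ?mulr_ge0 ?exprn_ge0.
- apply: le_J => //; first exact: continuousZ.
  move=> x x01; have /andP[s0 s1] := sin01 x01; have /andP[x0 xp] := x01.
  have -> : pi / 2 * (x ^+ m * sin x ^+ n) - x ^+ m.+1 * sin x ^+ n =
    x ^+ m * ((pi / 2 - x) * sin x ^+ n) by rewrite exprS; ring.
  rewrite expr0 mul1r expr1 -mulrBl ler_wpM2r ?mulr_ge0 ?subr_ge0 ?exprn_ge0//.
  by apply: lerXn2r; rewrite ?nnegrE// ltW.
Qed.

End trigonometric_moments.

(** * Gamma at half-integers *)

Section gamma_half_integers.
Variable R : realType.
Implicit Types F : R -> R.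
Local Notation mu := (@lebesgue_measure R).
Local Notation sqrt := (@Num.sqrt R).

(** The integrand of Gamma at [n / 2 + 1]; writing [t ^ (n / 2)] as a natural power of the root
    makes it continuous on the whole line. *)
Let phi n (t : R) := sqrt t ^+ n * expR (- t).

Let continuous_phi n : continuous (phi n).
Proof.
move=> t; rewrite /phi; apply: cvgM.
  apply: (@continuous_comp _ _ _ sqrt (fun x => x ^+ n)).
    exact: sqrt_continuous.
  exact: exprn_continuous.
apply: (@continuous_comp _ _ _ (fun t : R => - t) expR).
  by apply: cvgN; exact: cvg_id.
exact: continuous_expR.
Qed.

Let phi_ge0 n t : 0 <= phi n t.
Proof. by rewrite mulr_ge0 ?expR_ge0// exprn_ge0// sqrtr_ge0. Qed.

(** For [t >= 1], [sqrt t ^ n <= t ^ n] and [expR t >= t ^ (n + 1) / (n + 1)!]. *)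
Let cvgy_phi n : phi n t @[t --> +oo] --> 0.
Proof.
apply: (@squeeze_cvgr _ _ _ _ (cst 0) (fun t : R => (n.+1)`!%:R * t^-1)).
- near=> t; rewrite phi_ge0/= /phi expRN.
  have t1 : 1 <= t by near: t; exact: nbhs_pinfty_ge.
  have t0 : 0 < t by lra.
  have st : sqrt t <= t.
    rewrite -[leRHS](ger0_norm (ltW t0)) -sqrtr_sqr; apply: ler_wsqrtr.
    by rewrite expr2 ler_peMl// ltW.
  rewrite ler_pdivrMr ?expR_gt0//.
  apply: (@le_trans _ _ (t ^+ n)).
    by apply: lerXn2r; rewrite ?nnegrE ?sqrtr_ge0// ltW.
  have := expR_ge1Dxn n (ltW t0).
  move=> H; have {}H : t ^+ n.+1 / (n.+1)`!%:R <= expR t by lra.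
  apply: (@le_trans _ _ (n.+1`!%:R / t * (t ^+ n.+1 / (n.+1)`!%:R))).
    rewrite exprS le_eqVlt; apply/orP; left; apply/eqP; field.
    by rewrite !gt_eqF// ltr0n fact_gt0.
  by rewrite ler_wpM2l// divr_ge0// ltW.
- exact: cvg_cst.
- rewrite -[X in _ --> X](mulr0 (n.+1)`!%:R); apply: cvgMr.
  by apply/gtr0_cvgV0; [near=> t|exact: cvg_id].
Unshelve. all: by end_near. Qed.

Let phi_cvg0 n : phi n.+1 t @[t --> 0^'+] --> 0.
Proof.
rewrite -[X in _ --> X](_ : phi n.+1 0 = 0); last first.
  by rewrite /phi sqrtr0 expr0n mul0r.
by apply: cvg_at_right_filter; exact: continuous_phi.
Qed.

Let is_derive_expRN (t : R) : is_derive t 1 (fun t : R => expR (- t)) (- expR (- t)).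
Proof.
by apply: is_derive_eq; rewrite mulrN mulr1.
Qed.

Let is_derive_sqrtX n (t : R) : 0 < t ->
  is_derive t 1 (fun t => sqrt t ^+ n.+1) (n.+1%:R / 2 * (sqrt t ^+ n / sqrt t)).
Proof.
move=> t0; have ds := is_derive1_sqrt t0.
apply: is_derive_eq; first by apply: is_derive1X; exact: ds.
by rewrite /= invfM; ring.
Qed.

(** This certifies [l] as the value of Gamma at [n / 2 + 1]. Integration by parts and substitution
    then act on antiderivatives instead of improper integrals. *)
Definition half_antiderivative n (l : R) := exists F,
  [/\ F 0 = 0, F t @[t --> 0^'+] --> 0,
      forall t : R, 0 < t -> is_derive t 1 F (sqrt t ^+ n * expR (- t)) &
      F t @[t --> +oo] --> l].

Lemma half_antiderivative_Gamma n l :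
  half_antiderivative n l -> Gamma (n%:R / 2 + 1 : R) = l.
Proof.
move=> [F [F0 F0r dF Fl]].
rewrite /Gamma addrK.
under eq_Rintegral => t.
  rewrite inE/= in_itv/= andbT => t0.
  rewrite [n%:R / 2]mulrC powRrM powR12_sqrt; last exact: ltW.
  rewrite powR_mulrn ?sqrtr_ge0//.
  over.
rewrite /Rintegral integral_itv_obnd_cbnd; last first.
  apply/measurable_EFinP; apply: measurable_funTS.
  by apply: continuous_measurable_fun; exact: (@continuous_phi n).
rewrite -[LHS]/(\int[mu]_(x in `[0, +oo[) phi n x) -[RHS]subr0 -[X in _ = _ - X]F0.
apply: Rintegral_ge0_continuous_FTC2y => //.
- by apply: continuous_subspaceT; exact: continuous_phi.
- by move=> t t0; have [] := dF _ t0.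
- by rewrite F0.
- by move=> t; rewrite in_itv/= andbT => t0; rewrite derive1E; have [] := dF _ t0.
Qed.

(** The functional equation of Gamma at [n / 2 + 1], by parts: [phi n.+2] has derivative
    [(n / 2 + 1) * phi n - phi n.+2] and vanishes at both ends. *)
Lemma half_antiderivativeS n l : half_antiderivative n l ->
  half_antiderivative n.+2 ((n%:R / 2 + 1) * l).
Proof.
move=> [F [F0 F0r dF Fl]].
exists (fun t => (n%:R / 2 + 1) * F t - phi n.+2 t); split.
- by rewrite F0 /phi sqrtr0 expr0n mul0r mulr0 subr0.
- rewrite -[X in _ --> X](subr0 0) -[X in X - _](mulr0 (n%:R / 2 + 1)).
  by apply: cvgB; [apply: cvgMr|exact: phi_cvg0].
- move=> t t0; have dFt := dF _ t0.
  have ds := is_derive1M (@is_derive_sqrtX n.+1 t t0) (is_derive_expRN t).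
  apply: is_derive_eq (is_derive1B (is_derive1Zl _ dFt) ds) _.
  rewrite exprS [sqrt t * _]mulrC mulfK ?gt_eqF ?sqrtr_gt0//.
  by rewrite -(natr1 n.+1) -(natr1 n); field.
- rewrite -[X in _ --> X]subr0.
  by apply: cvgB; [apply: cvgMr|exact: cvgy_phi].
Qed.

Lemma half_antiderivative0 : half_antiderivative 0 1.
Proof.
exists (fun t => 1 - expR (- t)); split.
- by rewrite oppr0 expR0 subrr.
- rewrite -[X in _ --> X](subrr 1); apply: cvgB; first exact: cvg_cst.
  have -> : (1 : R) = expR (- 0) by rewrite oppr0 expR0.
  apply: cvg_at_right_filter.
  apply: (@continuous_comp _ _ _ (fun t : R => - t) expR).
    by apply: cvgN; exact: cvg_id.
  exact: continuous_expR.
- move=> t t0; have d1 := is_derive_cst (1 : R) t (1 : R).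
  apply: is_derive_eq (is_derive1B d1 (is_derive_expRN t)) _.
  by rewrite expr0 mul1r sub0r opprK.
- rewrite -[X in _ --> X]subr0; apply: cvgB; first exact: cvg_cst.
  exact: cvgr_expR.
Qed.

(** * Gamma at 3/2 from the Gaussian integral *)

Import gauss_integral_proof.

Let cvgy_sqrt : sqrt t @[t --> +oo] --> +oo.
Proof.
apply/cvgryPge => A; near=> t.
apply: le_trans (ler_norm A) _; rewrite -sqrtr_sqr; apply: ler_wsqrtr.
by near: t; apply: nbhs_pinfty_ge; exact: num_real.
Unshelve. all: by end_near. Qed.

Let integrable_gauss a : mu.-integrable `[0, a] (EFin \o @gauss_fun R).
Proof.
apply: continuous_compact_integrable; first exact: segment_compact.
by apply: continuous_subspaceT; exact: continuous_gauss_fun.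
Qed.

Let is_derive_gauss (x : R) : 0 < x ->
  is_derive x 1 (@integral0_gauss R) (expR (- x ^+ 2)).
Proof.
move=> x0.
have xx1 : x < x + 1 by rewrite ltrDl.
have [|dx] := continuous_FTC1 xx1 (integrable_gauss _) _ (@continuous_gauss_fun R x).
  exact: x0.
by rewrite derive1E => E; exact: DeriveDef.
Qed.

(** Integration by parts and the substitution [t = u ^ 2] turn the integral of [phi 1] up to [t]
    into the Gaussian integral up to [sqrt t], minus [phi 1 t]. *)
Lemma half_antiderivative1 : half_antiderivative 1 (sqrt (pi / 4)).
Proof.
exists (fun t => integral0_gauss (sqrt t) - phi 1 t); split.
- rewrite sqrtr0 /phi sqrtr0 expr1 mul0r subr0 /integral0_gauss set_itv1.
  by rewrite Rintegral_set1.
- rewrite -[X in _ --> X](subr0 0); apply: cvgB; last exact: phi_cvg0.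
  have c01 : {within `[0, 1], continuous (@integral0_gauss R)}.
    by apply: parameterized_integral_continuous => //; exact: integrable_gauss.
  have /(continuous_within_itvP _ ltr01)[_ + _] := c01.
  rewrite {2}/integral0_gauss set_itv1 Rintegral_set1 => G0.
  apply: (@increasing_cvg_at_right_comp R sqrt integral0_gauss 0 (BInfty R false)).
  + by [].
  + move=> x y; rewrite !in_itv/= !andbT => x0 y0 xy.
    by rewrite ltr_sqrt//; apply: le_lt_trans x0 xy.
  + by apply: cvg_at_right_filter; exact: sqrt_continuous.
  + by rewrite sqrtr0.
- move=> t t0; have st0 : 0 < sqrt t by rewrite sqrtr_gt0.
  have ds := is_derive1_sqrt t0; have dg := is_derive_gauss st0.
  have dp := is_derive1M (@is_derive_sqrtX 0 t t0) (is_derive_expRN t).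
  apply: is_derive_eq (is_derive1B (is_derive1_comp dg ds) dp) _.
  rewrite sqr_sqrtr ?ltW// expr0 expr1 invfM.
  by field; rewrite gt_eqF.
- rewrite -[X in _ --> X]subr0; apply: cvgB; last exact: cvgy_phi.
  apply: (cvg_comp _ _ cvgy_sqrt).
  have := @cvg_integral0_gauss_sqr R.
  move=> /(cvg_comp _ _)/(_ (@sqrt_continuous R (pi / 4))).
  apply: cvg_trans; apply: near_eq_cvg; near=> x => /=.
  by rewrite sqrtr_sqr ger0_norm// integral0_gauss_ge0.
Unshelve. all: by end_near. Qed.

(** The recursion has step 2, so the induction carries two consecutive indices. *)
Lemma exists_half_antiderivative n : exists l, half_antiderivative n l.
Proof.
suff : (exists l, half_antiderivative n l) /\ (exists l, half_antiderivative n.+1 l) by case.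
elim: n => [|n [[l hl] IH]].
  split; first by exists 1; exact: half_antiderivative0.
  by exists (sqrt (pi / 4)); exact: half_antiderivative1.
by split=> //; exists ((n%:R / 2 + 1) * l); exact: half_antiderivativeS.
Qed.

Lemma Gamma_halfS n :
  Gamma (n.+2%:R / 2 + 1 : R) = (n%:R / 2 + 1) * Gamma (n%:R / 2 + 1 : R).
Proof.
have [l hl] := exists_half_antiderivative n.
by rewrite (half_antiderivative_Gamma hl) (half_antiderivative_Gamma (half_antiderivativeS hl)).
Qed.

Lemma Gamma1 : Gamma (0 / 2 + 1 : R) = 1.
Proof. exact: half_antiderivative_Gamma half_antiderivative0. Qed.

Lemma Gamma32 : Gamma (1 / 2 + 1 : R) = sqrt (pi / 4).
Proof. exact: half_antiderivative_Gamma half_antiderivative1. Qed.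

Lemma Gamma_half_gt0 n : 0 < Gamma (n%:R / 2 + 1 : R).
Proof.
suff : 0 < Gamma (n%:R / 2 + 1 : R) /\ 0 < Gamma (n.+1%:R / 2 + 1 : R) by case.
elim: n => [|n [IH1 IH2]].
  by rewrite Gamma1 Gamma32 sqrtr_gt0 divr_gt0 ?pi_gt0.
by split=> //; rewrite Gamma_halfS mulr_gt0.
Qed.

Lemma Gamma_natS n : Gamma (n.+1%:R + 1 : R) = (n%:R + 1) * Gamma (n%:R + 1 : R).
Proof.
have E k : (k%:R : R) = (2 * k)%N%:R / 2 by rewrite natrM; field.
have -> : n.+1%:R = (2 * n).+2%:R / 2 :> R by rewrite E mulnS.
by rewrite Gamma_halfS -E.
Qed.

Lemma cbinom0 : cbinom R 0 = 1.
Proof.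
have := Gamma1; rewrite /cbinom mul0r => ->.
by rewrite expr1n divr1.
Qed.

Lemma cbinom1 : cbinom R 1 = 4 / pi.
Proof.
rewrite /cbinom Gamma_natS Gamma32 sqr_sqrtr ?divr_ge0 ?pi_ge0//.
have := Gamma1; rewrite mul0r => ->.
by rewrite add0r !mul1r invf_div.
Qed.

Lemma cbinomS n : (n%:R + 2) * cbinom R n.+2 = 4 * (n%:R + 1) * cbinom R n.
Proof.
have n0 : (0 : R) <= n%:R by [].
rewrite /cbinom !Gamma_natS Gamma_halfS.
have := Gamma_half_gt0 n; set g := Gamma (n%:R / 2 + 1) => g0.
rewrite -(natr1 n).
by field; rewrite !gt_eqF//; lra.
Qed.

Lemma cbinom_gt0 n : 0 < cbinom R n.
Proof.
suff h : 0 < Gamma (n%:R + 1 : R) by rewrite divr_gt0// exprn_gt0// Gamma_half_gt0.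
elim: n => [|n IH]; first by have := Gamma_half_gt0 0; rewrite mul0r.
by rewrite Gamma_natS mulr_gt0.
Qed.

End gamma_half_integers.

(** * Identification and limits *)

Section wallis.
Variable R : realType.
Local Notation I := (@sinmoment R).
Local Notation W := (@sinmoment R 0).

Lemma wallis0 : W 0 = pi / 2.
Proof. by rewrite sinmoment_n0 expr1 divr1. Qed.

Lemma wallis1 : W 1 = 1.
Proof. by rewrite sinmoment_id1 !mul0r subr0 add0r. Qed.

Lemma wallisS n : (n%:R + 2) * W n.+2 = (n%:R + 1) * W n.
Proof.
have n0 : (0 : R) <= n%:R by [].
have n2 : n%:R + 2 != 0 :> R by rewrite gt_eqF//; lra.
apply: (mulfI n2); have := @sinmoment_rec R 0 n.
by rewrite !mul0r subr0 addr0 => E; rewrite mulrA -expr2 E; ring.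
Qed.

Lemma wallis_gt0 n : 0 < W n.
Proof.
suff : 0 < W n /\ 0 < W n.+1 by case.
elim: n => [|n [IH1 IH2]].
  by rewrite wallis0 wallis1 divr_gt0 ?pi_gt0.
split=> //; have n0 : (0 : R) <= n%:R by [].
have n2 : 0 < n%:R + 2 :> R by lra.
by rewrite -(pmulr_rgt0 _ n2) wallisS mulr_gt0//; lra.
Qed.

(** By [wallisS] the left side does not depend on [n]. This fixes the size of [W n] without any
    asymptotic formula. *)
Lemma wallisM n : (n%:R + 1) * (W n * W n.+1) = pi / 2.
Proof.
elim: n => [|n IH]; first by rewrite wallis0 wallis1 mulr1 add0r mul1r.
rewrite -IH -(natr1 n).
have -> : (n%:R + 1 + 1) * (W n.+1 * W n.+2) = W n.+1 * ((n%:R + 2) * W n.+2) by ring.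
by rewrite wallisS; ring.
Qed.

(** By [cbinomS] and [wallisS] both sides obey the same recurrence of step 2, and they agree at 0
    and 1. *)
Lemma cbinom_wallis n : cbinom R n * pi = 2 ^+ n.+1 * W n.
Proof.
suff : cbinom R n * pi = 2 ^+ n.+1 * W n /\ cbinom R n.+1 * pi = 2 ^+ n.+2 * W n.+1 by case.
elim: n => [|n [IH1 IH2]].
  rewrite cbinom0 cbinom1 wallis0 wallis1 divfK ?gt_eqF ?pi_gt0//.
  by split; [field|ring].
split=> //; have n0 : (0 : R) <= n%:R by [].
have n2 : n%:R + 2 != 0 :> R by rewrite gt_eqF//; lra.
apply: (mulfI n2); rewrite mulrA cbinomS [RHS]mulrCA wallisS.
transitivity (4 * (n%:R + 1) * (cbinom R n * pi)); first by ring.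
by rewrite IH1 !exprS; ring.
Qed.

Lemma cbinomV n : 2 ^+ n.+1 / cbinom R n = pi / W n.
Proof.
have c0 : cbinom R n != 0 by rewrite gt_eqF// cbinom_gt0.
have w0 : W n != 0 by rewrite gt_eqF// wallis_gt0.
by apply/eqP; rewrite eqr_div// -cbinom_wallis mulrC.
Qed.

Lemma cvg_wallis : W @ \oo --> 0.
Proof.
have sqr0 : (fun n => W n.+1 ^+ 2) @ \oo --> 0.
  apply: (@squeeze_cvgr _ _ _ _ (cst 0) (fun n : nat => pi / 2 * harmonic n)).
  - near=> n; rewrite sqr_ge0/= /harmonic -(wallisM n) -(natr1 n).
    have n1 : n%:R + 1 != 0 :> R by rewrite natr1.
    rewrite mulrAC mulfV// mul1r expr2 ler_wpM2r ?sinmoment_ge0//.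
    exact: sinmoment_nonincr.
  - exact: cvg_cst.
  - by rewrite -[X in _ --> X](mulr0 (pi / 2)); apply: cvgMr; exact: cvg_harmonic.
rewrite -cvg_shiftS; have := cvg_comp _ _ sqr0 (@sqrt_continuous R 0).
rewrite sqrtr0; apply: cvg_trans; apply: near_eq_cvg; near=> n => /=.
by rewrite sqrtr_sqr ger0_norm// sinmoment_ge0.
Unshelve. all: by end_near. Qed.

(** At [n + 1] the numerator is at most [1 / (n + 1)], and [wallisM] rewrites
    [1 / ((n + 1) W (n + 1))] as [(2 / pi) W n], which tends to 0. *)
Let cvg_defect : (pi / 2 * W n - I 1 n) / W n @[n --> \oo] --> 0.
Proof.
rewrite -cvg_shiftS.
apply: (@squeeze_cvgr _ _ _ _ (cst 0) (fun n : nat => W n * (2 / pi))).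
- near=> n; have /andP[h _] := @sinmomentS_le R 0 n.+1.
  have n0 : (0 : R) <= n%:R by [].
  rewrite divr_ge0 ?sinmoment_ge0//= ler_pdivrMr ?wallis_gt0//.
  apply: le_trans (@sinmoment01_le R n) _.
  have w := wallisM n; have p0 : pi != 0 :> R by rewrite gt_eqF ?pi_gt0.
  have n1 : n%:R + 1 != 0 :> R by rewrite natr1 pnatr_eq0.
  have -> : W n * (2 / pi) * W n.+1 = (pi / 2) / (n%:R + 1) * (2 / pi).
    by rewrite -w [(n%:R + 1) * _]mulrC mulfK// mulrAC.
  by rewrite mulrAC -[2 / pi]invf_div divff ?mul1r// mulf_neq0.
- exact: cvg_cst.
- by rewrite -[X in _ --> X](mul0r (2 / pi)); apply: cvgMl; exact: cvg_wallis.
Unshelve. all: by end_near. Qed.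

Lemma cvg_sinmoment m : I m n / W n @[n --> \oo] --> (pi / 2) ^+ m.
Proof.
elim: m => [|m IH].
  rewrite expr0; under eq_fun do rewrite mulfV ?gt_eqF ?wallis_gt0//.
  exact: cvg_cst.
have E n : I m.+1 n / W n =
    pi / 2 * (I m n / W n) - (pi / 2 * I m n - I m.+1 n) / W n by ring.
rewrite exprS -[X in _ --> X]subr0; under eq_fun do rewrite E.
apply: cvgB; first exact: cvgMr.
apply: (@squeeze_cvgr _ _ _ _ (cst 0)
    (fun n => (pi / 2) ^+ m * ((pi / 2 * W n - I 1 n) / W n))).
- near=> n; have /andP[h0 h1] := @sinmomentS_le R m n.
  rewrite divr_ge0 ?sinmoment_ge0//= mulrA ler_wpM2r//.
  by rewrite invr_ge0 sinmoment_ge0.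
- exact: cvg_cst.
- by rewrite -[X in _ --> X](mulr0 ((pi / 2) ^+ m)); apply: cvgMr; exact: cvg_defect.
Unshelve. all: by end_near. Qed.

(* The difference [d] of two solutions satisfies [(n + 2) d (n + 2) = (n + 1) d n],
   hence vanishes at odd arguments and is proportional to [W] at even ones; by
   monotonicity [d (2 m + 2)] is at most a decrement of [y], which is [o(W)]. *)
Lemma wallis_recurrence_uniq (x y f : nat -> R) (C : R) :
  (forall n, x n.+1 <= x n) -> (forall n, y n.+1 <= y n) ->
  (forall n, 0 <= f n) ->
  (forall n, (n%:R + 2) ^+ 2 * x n.+2 = (n%:R + 1) * (n%:R + 2) * x n + f n) ->
  (forall n, (n%:R + 2) ^+ 2 * y n.+2 = (n%:R + 1) * (n%:R + 2) * y n + f n) ->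
  x 1 = y 1 -> (forall n, y n <= C * W n) -> 0 <= C -> x =1 y.
Proof.
move=> xdec ydec f0 xrec yrec xy1 yC C0.
pose d n := x n - y n.
have drec n : (n%:R + 2) * d n.+2 = (n%:R + 1) * d n.
  have n0 : (0 : R) <= n%:R by [].
  have n2 : n%:R + 2 != 0 :> R by rewrite gt_eqF//; lra.
  apply: (mulfI n2); have := xrec n; have := yrec n.
  rewrite /d => E1 E2.
  transitivity ((n%:R + 2) ^+ 2 * x n.+2 - (n%:R + 2) ^+ 2 * y n.+2); first by ring.
  by rewrite E1 E2; ring.
have n2 n : n%:R + 2 != 0 :> R.
  by rewrite gt_eqF//; have n0 : (0 : R) <= n%:R by []; lra.
have dodd m : d m.*2.+1 = 0.
  elim: m => [|m IH]; first by rewrite /d xy1 subrr.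
  by rewrite doubleS; apply: (mulfI (n2 m.*2.+1)); rewrite drec IH !mulr0.
have deven m : d m.*2 * W 0 = d 0 * W m.*2.
  elim: m => [//|m IH]; rewrite doubleS; apply: (mulfI (n2 m.*2)).
  by rewrite mulrA drec mulrCA wallisS -mulrA IH; ring.
have dle m : `|d m.+1.*2| * (m.*2%:R + 2) <= C * W m.+1.*2.
  rewrite doubleS; set n := m.*2.+1.
  have n0 : (0 : R) <= n%:R by [].
  have nE : (m.*2%:R : R) = n%:R - 1 by rewrite /n -natr1; lra.
  have h1 : x n = y n by have := dodd m; rewrite /d -/n; lra.
  have h2 : x n.+2 = y n.+2 by have := dodd m.+1; rewrite doubleS /d -/n; lra.
  (* Here [x] and [y] agree at the odd indices [n] and [n + 2], so by monotonicity [x (n + 1)] and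
     [y (n + 1)] both lie between [y (n + 2)] and [y n]. *)
  have hd : `|d n.+1| <= y n - y n.+2.
    have := xdec n; have := xdec n.+1; have := ydec n; have := ydec n.+1.
    by rewrite h1 h2 /d => *; rewrite ler_norml; apply/andP; split; lra.
  have hy : (n%:R + 2) * (y n - y n.+2) <= y n.
    have n2p : 0 < n%:R + 2 :> R by lra.
    rewrite -(ler_pM2l n2p).
    have -> : (n%:R + 2) * ((n%:R + 2) * (y n - y n.+2)) =
      (n%:R + 2) ^+ 2 * y n - (n%:R + 2) ^+ 2 * y n.+2 by ring.
    rewrite yrec; have := f0 n.
    have -> : (n%:R + 2) ^+ 2 * y n = (n%:R + 1) * (n%:R + 2) * y n + (n%:R + 2) * y n by ring.
    lra.
  have hW : (n%:R + 1) * W n <= (n%:R + 2) * W n.+1.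
    by rewrite -wallisS ler_wpM2l ?sinmoment_nonincr//; lra.
  have n2p : 0 < n%:R + 2 :> R by lra.
  rewrite nE -(ler_pM2l n2p).
  apply: (@le_trans _ _ ((n%:R + 1) * (C * W n))); last first.
    by rewrite mulrCA [leRHS]mulrCA ler_wpM2l.
  have -> : (n%:R + 2) * (`|d n.+1| * (n%:R - 1 + 2)) =
    (n%:R + 1) * ((n%:R + 2) * `|d n.+1|) by ring.
  rewrite ler_wpM2l//.
  apply: le_trans (yC n); apply: le_trans hy; rewrite ler_wpM2l//; lra.
have d0 : d 0 = 0.
  apply/eqP; rewrite -normr_le0 leNgt; apply/negP => dpos.
  have w0 := wallis_gt0 0.
  (* Substituting [deven] in [dle] and cancelling [W (2 m + 2)] leaves a bound uniform in [m],
     contradicting the Archimedean property if [d 0] is nonzero. *)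
  have key m : `|d 0%N| * (m.*2%:R + 2) <= C * W 0.
    have wm := wallis_gt0 m.+1.*2.
    rewrite -(ler_pM2r wm).
    have -> : `|d 0%N| * (m.*2%:R + 2) * W m.+1.*2 =
      `|d m.+1.*2| * (m.*2%:R + 2) * W 0.
      rewrite mulrAC -[W m.+1.*2]ger0_norm ?sinmoment_ge0// -normrM -deven normrM.
      by rewrite [`|W 0|]ger0_norm ?sinmoment_ge0// mulrAC.
    by rewrite [leRHS]mulrAC ler_wpM2r ?sinmoment_ge0.
  have [m hm] : exists m : nat, C * W 0 / `|d 0%N| < m%:R.
    exists (Num.bound (C * W 0 / `|d 0%N|)); apply: archi_boundP.
    by rewrite divr_ge0// mulr_ge0 ?sinmoment_ge0.
  have := key m; rewrite mulrC -ler_pdivlMr//.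
  rewrite -addnn natrD; have m0 : (0 : R) <= m%:R by []; lra.
move=> n; apply/eqP; rewrite -subr_eq0 -/(d n); apply/eqP.
rewrite -(odd_double_half n); case: (odd n); first exact: dodd.
by apply: (mulIf (lt0r_neq0 (wallis_gt0 0))); rewrite add0n deven d0 !mul0r.
Qed.

(** * The four series as sine moments *)

Let ge1_1 : (1 : R) <= 1%:R. Proof. by []. Qed.
Let ge1_2 : (1 : R) <= 2%:R. Proof. by rewrite ler1n. Qed.

Let pihalfX_ge0 m : 0 <= (pi / 2) ^+ m :> R.
Proof. by rewrite exprn_ge0// divr_ge0 ?pi_ge0. Qed.

Lemma wser1E : wser R 1 =1 W.
Proof.
apply: (@wallis_recurrence_uniq _ _ (fun=> 0) 1) => //.
- by move=> n; exact: wser_nonincr.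
- by move=> n; exact: sinmoment_nonincr.
- move=> n; have := wser_rec ge1_1 n; have n0 : (0 : R) <= n%:R by [].
  rewrite subrr addr0 => E.
  have n1 : n%:R + 1 != 0 :> R by rewrite gt_eqF//; lra.
  apply: (mulfI n1).
  transitivity ((n%:R + 2) * ((n%:R + 2) * (n%:R + 1) * wser R 1 n.+2)); first by ring.
  by rewrite E; ring.
- by move=> n; rewrite sinmoment_rec !mul0r subr0.
- by rewrite (wser1 ge1_1) wallis1.
- by move=> n; rewrite mul1r.
Qed.

Lemma wser2E : wser R 2 =1 I 1.
Proof.
apply: (@wallis_recurrence_uniq _ _ (fun=> 1) (pi / 2)) => //.
- by move=> n; exact: wser_nonincr.
- by move=> n; exact: sinmoment_nonincr.
- move=> n; have := wser_rec ge1_2 n.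
  by rewrite -expr2 => ->; ring.
- by move=> n; rewrite sinmoment_rec/= expr0 mulr0 mul0r subr0 mul1r.
- by rewrite (wser1 ge1_2) sinmoment_id1/= expr0 mulr0 mul0r subr0 mul1r addr0.
- by move=> n; have := @sinmoment_le R 1 n; rewrite expr1.
- exact: (pihalfX_ge0 1).
Qed.

(** The forcing term of [I 2] is [pi - 2 W (n + 2) = 2 (W 0 - W (n + 2))], whence the factor 2. *)
Lemma wserK1E n : wserK R 1 n = I 2 n / 2.
Proof.
move: n; apply: (@wallis_recurrence_uniq _ _ (fun n => W 0 - W n.+2) ((pi / 2) ^+ 2)).
- by move=> n; exact: wserK_nonincr.
- by move=> n; rewrite ler_pM2r ?invr_gt0//; exact: sinmoment_nonincr.
- move=> n; rewrite subr_ge0.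
  by elim: n.+2 => // k; apply: le_trans; exact: sinmoment_nonincr.
- by move=> n; rewrite (wserK_rec ge1_1) !wser1E.
- by move=> n; rewrite mulrA sinmoment_rec/= expr1 wallis0; field.
- rewrite (wserK1 ge1_1) (wser1E 0) (wser1E 1) (@sinmoment_id1 R 2).
  by rewrite wallis0 /= wallis1 expr1; field.
- move=> n; apply: le_trans (@sinmoment_le R 2 n).
  by rewrite ler_pdivrMr// ler_peMr ?sinmoment_ge0// ler1n.
- exact: pihalfX_ge0.
Qed.

(** Since [I 1 0 = (pi / 2) ^ 2 / 2], the forcing term [3 (pi / 2) ^ 2 - 6 I 1 (n + 2)] of [I 3] is
    6 times that of [wserK R 2]. *)
Lemma wserK2E n : wserK R 2 n = I 3 n / 6.
Proof.
move: n; apply: (@wallis_recurrence_uniq _ _ (fun n => I 1 0 - I 1 n.+2) ((pi / 2) ^+ 3)).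
- by move=> n; exact: wserK_nonincr.
- by move=> n; rewrite ler_pM2r ?invr_gt0//; exact: sinmoment_nonincr.
- move=> n; rewrite subr_ge0.
  by elim: n.+2 => // k; apply: le_trans; exact: sinmoment_nonincr.
- by move=> n; rewrite (wserK_rec ge1_2) !wser2E.
- by move=> n; rewrite mulrA sinmoment_rec/= sinmoment_n0; field.
- rewrite (wserK1 ge1_2) (wser2E 0) (wser2E 1) (@sinmoment_id1 R 3) (@sinmoment_id1 R 1).
  by rewrite (@sinmoment_n0 R 1) /=; field.
- move=> n; apply: le_trans (@sinmoment_le R 3 n).
  by rewrite ler_pdivrMr// ler_peMr ?sinmoment_ge0// ler1n.
- exact: pihalfX_ge0.
Qed.

(** * Central binomial coefficients and the partial sums of the theorem *)

Lemma central_binS k : (k.+1 * k.+1 * 'C(2 * k.+1, k.+1))%N =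
  (2 * k.+1 * (2 * k).+1 * 'C(2 * k, k))%N.
Proof.
have -> : (2 * k.+1 = (2 * k).+2)%N by rewrite mulnS.
have E1 := mul_bin_down (2 * k).+1 k.
have E2 := mul_bin_diag (2 * k).+2 k.
have K : ((2 * k).+1 - k = k.+1)%N.
  by rewrite subSn ?leq_pmull// mul2n -addnn addnK.
rewrite K /= in E1 E2.
by rewrite -!mulnA -E2 E1 mulnCA.
Qed.

Let bin_gt0' k : (0 : R) < 'C(2 * k, k)%:R.
Proof. by rewrite ltr0n bin_gt0 leq_pmull. Qed.

Lemma central_binSR k : 'C(2 * k.+1, k.+1)%:R =
  'C(2 * k, k)%:R * (2 * (2 * k%:R + 1) / (k%:R + 1)) :> R.
Proof.
have k0 : (0 : R) <= k%:R by [].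
have := congr1 (fun m : nat => m%:R : R) (central_binS k).
rewrite /= !natrM -(natr1 (2 * k)) natrM -(natr1 k) => E.
apply: (@mulfI _ ((k%:R + 1) * (k%:R + 1))); first by rewrite gt_eqF//; nra.
by rewrite E; field; rewrite gt_eqF//; lra.
Qed.

Lemma wcoef1E k : wcoef R 1 k = 'C(2 * k, k)%:R / 4 ^+ k.
Proof.
elim: k => [|k IH]; first by rewrite wcoef0 bin0 expr0 divr1.
have k0 : (0 : R) <= k%:R by [].
rewrite wcoefS IH central_binSR exprS.
by field; rewrite expf_neq0 ?pnatr_eq0//= !gt_eqF//; lra.
Qed.

Lemma wcoef2E k :
  2 * wcoef R 2 k = 4 ^+ k.+1 / ('C(2 * k.+1, k.+1)%:R * k.+1%:R).
Proof.
elim: k => [|k IH].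
  by rewrite wcoef0 muln1 bin1 expr1; field.
have k0 : (0 : R) <= k%:R by [].
rewrite wcoefS mulrA IH (central_binSR k.+1) (exprS _ k.+1) -!(natr1 k.+1) -!(natr1 k).
have := bin_gt0' k.+1; set b := 'C(_, _)%:R => b0.
by field; rewrite !gt_eqF//; lra.
Qed.

Lemma isqsum1E k : isqsum R 1 k = Gsum R k.
Proof. by rewrite /isqsum /Gsum big_mkord. Qed.

Lemma isqsum2E k : isqsum R 2 k = Hsum R k.+1.
Proof.
rewrite /isqsum /Hsum big_add1 big_mkord; apply: eq_bigr => i _.
by rewrite -(natr1 i); congr (_ / _ ^+ 2); ring.
Qed.

Lemma wsum1E N n : wsum R 1 N n = \sum_(0 <= k < N)
  'C(2 * k, k)%:R / (4 ^+ k * (2 * k%:R + n%:R + 1)).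
Proof.
by rewrite /wsum big_mkord; apply: eq_bigr => k _; rewrite wcoef1E invfM mulrA.
Qed.

Lemma wsumK1E N n : wsumK R 1 N n = \sum_(0 <= k < N)
  'C(2 * k, k)%:R * Gsum R k / (4 ^+ k * (2 * k%:R + n%:R + 1)).
Proof.
rewrite /wsumK big_mkord; apply: eq_bigr => k _.
by rewrite wcoef1E isqsum1E invfM; ring.
Qed.

Lemma wsum2E N n : 2 * wsum R 2 N n = \sum_(1 <= k < N.+1)
  4 ^+ k / ('C(2 * k, k)%:R * k%:R * (2 * k%:R + n%:R)).
Proof.
rewrite /wsum big_add1 big_mkord mulr_sumr; apply: eq_bigr => k _.
rewrite mulrA wcoef2E -[LHS]mulrA -invfM; congr (_ / (_ * _)).
by rewrite -(natr1 k); ring.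
Qed.

Lemma wsumK2E N n : 2 * wsumK R 2 N n = \sum_(1 <= k < N.+1)
  4 ^+ k * Hsum R k / ('C(2 * k, k)%:R * k%:R * (2 * k%:R + n%:R)).
Proof.
rewrite /wsumK big_add1 big_mkord mulr_sumr; apply: eq_bigr => k _.
rewrite !mulrA wcoef2E isqsum2E [_ * Hsum _ _]mulrAC -[LHS]mulrA -invfM.
by congr (_ / (_ * _)); rewrite -(natr1 k); ring.
Qed.

End wallis.

(* The first conjunct of each pair says that the infinite sum in the second
   one, which is the limit of its partial sums, exists. *)
Theorem corollary8p1 (R : realType) :
  [/\ (forall n : nat, (0 < n)%N ->
         cvgn (fun N : nat => \sum_(0 <= k < N)
           'C(2 * k, k)%:R / (4 ^+ k * (2 * k%:R + n%:R + 1)) : R)) /\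
      (2 ^+ n.+1 / cbinom R n *
         limn (fun N : nat => \sum_(0 <= k < N)
           'C(2 * k, k)%:R / (4 ^+ k * (2 * k%:R + n%:R + 1)) : R)
       @[n --> \oo] --> (pi : R)),

      (forall n : nat, (0 < n)%N ->
         cvgn (fun N : nat => \sum_(1 <= k < N)
           4 ^+ k / ('C(2 * k, k)%:R * k%:R * (2 * k%:R + n%:R)) : R)) /\
      (2 ^+ n.+1 / cbinom R n *
         limn (fun N : nat => \sum_(1 <= k < N)
           4 ^+ k / ('C(2 * k, k)%:R * k%:R * (2 * k%:R + n%:R)) : R)
       @[n --> \oo] --> (pi ^+ 2 : R)),

      (forall n : nat, (0 < n)%N ->
         cvgn (fun N : nat => \sum_(0 <= k < N)
           'C(2 * k, k)%:R * Gsum R k / (4 ^+ k * (2 * k%:R + n%:R + 1)) : R)) /\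
      (2 * (2 ^+ (n + 3) / cbinom R n) *
         limn (fun N : nat => \sum_(0 <= k < N)
           'C(2 * k, k)%:R * Gsum R k / (4 ^+ k * (2 * k%:R + n%:R + 1)) : R)
       @[n --> \oo] --> (pi ^+ 3 : R)) &

      (forall n : nat, (0 < n)%N ->
         cvgn (fun N : nat => \sum_(1 <= k < N)
           4 ^+ k * Hsum R k / ('C(2 * k, k)%:R * k%:R * (2 * k%:R + n%:R)) : R)) /\
      (6 * (2 ^+ (n + 3) / cbinom R n) *
         limn (fun N : nat => \sum_(1 <= k < N)
           4 ^+ k * Hsum R k / ('C(2 * k, k)%:R * k%:R * (2 * k%:R + n%:R)) : R)
       @[n --> \oo] --> (pi ^+ 4 : R))].

Proof.
have le11 : (1 : R) <= 1%:R by [].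
have le12 : (1 : R) <= 2%:R by rewrite ler1n.
have cvg1 (n : nat) : (\sum_(0 <= k < N)
    'C(2 * k, k)%:R / (4 ^+ k * (2 * k%:R + n%:R + 1)) : R) @[N --> \oo]
    --> sinmoment R 0 n.
  by under eq_fun do rewrite -wsum1E; rewrite -wser1E; exact: is_cvg_wsum.
have cvg2 (n : nat) : (\sum_(1 <= k < N)
    4 ^+ k / ('C(2 * k, k)%:R * k%:R * (2 * k%:R + n%:R)) : R) @[N --> \oo]
    --> 2 * sinmoment R 1 n.
  (* The series starts at [k = 1], so its partial sum below [N + 1] matches [wsum] with [N]
     terms. *)
  rewrite -cvg_shiftS; under eq_fun do rewrite -wsum2E; rewrite -wser2E.
  by apply: cvgMr; exact: is_cvg_wsum.
have cvg3 (n : nat) : (\sum_(0 <= k < N)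
    'C(2 * k, k)%:R * Gsum R k / (4 ^+ k * (2 * k%:R + n%:R + 1)) : R) @[N --> \oo]
    --> sinmoment R 2 n / 2.
  by under eq_fun do rewrite -wsumK1E; rewrite -wserK1E; exact: is_cvg_wsumK.
have cvg4 (n : nat) : (\sum_(1 <= k < N)
    4 ^+ k * Hsum R k / ('C(2 * k, k)%:R * k%:R * (2 * k%:R + n%:R)) : R) @[N --> \oo]
    --> 2 * (sinmoment R 3 n / 6).
  rewrite -cvg_shiftS; under eq_fun do rewrite -wsumK2E; rewrite -wserK2E.
  by apply: cvgMr; exact: is_cvg_wsumK.
have cbinomV3 (n : nat) : 2 ^+ (n + 3) / cbinom R n = 4 * (pi / sinmoment R 0 n).
  by rewrite -cbinomV addnS addn2 !exprS; ring.
(* Applied with [m] = 0, 1, 2, 3 and [a] = [pi], [2 pi], [4 pi], [8 pi], so that the limit is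
   [pi ^ (m + 1)] each time. *)
have cvg_ratio (a : R) m (u : nat -> R) :
    (forall n, u n = a * (sinmoment R m n / sinmoment R 0 n)) ->
    u n @[n --> \oo] --> a * (pi / 2) ^+ m.
  by move=> E; under eq_fun do rewrite E; apply: cvgMr; exact: cvg_sinmoment.
split; split=> [n _|].
- by apply/cvg_ex; exists (sinmoment R 0 n); exact: cvg1.
- rewrite (_ : pi = pi * (pi / 2) ^+ 0); last by rewrite expr0 mulr1.
  apply: cvg_ratio => n; rewrite (cvg_lim _ (cvg1 n))// cbinomV.
  by rewrite mulrAC mulrA.
- by apply/cvg_ex; exists (2 * sinmoment R 1 n); exact: cvg2.
- rewrite (_ : pi ^+ 2 = 2 * pi * (pi / 2) ^+ 1); last by field.
  by apply: cvg_ratio => n; rewrite (cvg_lim _ (cvg2 n))// cbinomV; ring.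
- by apply/cvg_ex; exists (sinmoment R 2 n / 2); exact: cvg3.
- rewrite (_ : pi ^+ 3 = 4 * pi * (pi / 2) ^+ 2); last by field.
  apply: cvg_ratio => n; rewrite (cvg_lim _ (cvg3 n))// cbinomV3.
  by move: (sinmoment R 0 n)^-1 => w; field.
- by apply/cvg_ex; exists (2 * (sinmoment R 3 n / 6)); exact: cvg4.
- rewrite (_ : pi ^+ 4 = 8 * pi * (pi / 2) ^+ 3); last by field.
  apply: cvg_ratio => n; rewrite (cvg_lim _ (cvg4 n))// cbinomV3.
  by move: (sinmoment R 0 n)^-1 => w; field.
Qed.
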